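(* Let $n\ge 2$ and let $-1\le\alpha<\beta\le 1$ with $\beta^2\ge\alpha^2$. Let $B_{\alpha\beta}=\{x\in\mathbb{R}^n:\|x\|\le 1,\ \alpha\le x_1\le\beta\}$. The minimum volume circumscribed ellipsoid $\mathrm{CE}(B_{\alpha\beta})$ has the form $E(X,c)$ where $c=\tau e_1$ and $X=\mathrm{diag}(a,b,\ldots,b)$, where the parameters $a>0$, $b>0$ and $\alpha<\tau<\beta$ are given as follows: (i) If $\alpha\beta\le -1/n$, then $\tau=0$ and $a=b=1$. (ii) If $\alpha+\beta=0$ and $\alpha\beta>-1/n$, then $$\tau=0,\qquad a=\frac{1}{n\beta^2},\qquad b=\frac{n-1}{n(1-\beta^2)}.$$ (iii) If $\alpha+\beta\ne 0$ and $\alpha\beta>-1/n$, then $$\tau=\frac{n(\beta+\alpha)^2+2(1+\alpha\beta)-\sqrt{\Delta}}{2(n+1)(\beta+\alpha)},\qquad a=\frac{1}{n(\tau-\alpha)(\beta-\tau)},\qquad b=\frac{1-a(\tau-\alpha)^2}{1-\alpha^2},$$ where $\Delta=n^2(\beta^2-\alpha^2)^2+4(1-\alpha^2)(1-\beta^2)$.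
   Context: For a symmetric positive definite $n\times n$ matrix $X$ and $c\in\mathbb{R}^n$, $E(X,c)=\{x\in\mathbb{R}^n:\langle X(x-c),x-c\rangle\le 1\}$ (an ellipsoid with nonempty interior). A convex body is a compact convex set with nonempty interior. For a convex body $K\subset\mathbb{R}^n$, $\mathrm{CE}(K)$ denotes the unique ellipsoid of minimum volume containing $K$. $e_1=(1,0,\ldots,0)^T$, and $\|\cdot\|$ is the Euclidean norm. *)

(* Defs.v *)
From HB Require Import structures.
From mathcomp Require Import all_boot all_order all_algebra.
From mathcomp Require Import all_classical all_reals all_analysis.

Set Implicit Arguments.
Unset Strict Implicit.
Unset Printing Implicit Defensive.

Import Order.TTheory GRing.Theory Num.Theory.

Local Open Scope classical_set_scope.
Local Open Scope ring_scope.

Definition tuple_of_prod (T : Type) (n : nat) (p : T * n.-tuple T) :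
  n.+1.-tuple T := [tuple of p.1 :: p.2].

Definition prod_of_tuple (T : Type) (n : nat) (t : n.+1.-tuple T) :
  T * n.-tuple T := (thead t, [tuple of behead t]).

Lemma tuple_of_prodK (T : Type) (n : nat) :
  cancel (@tuple_of_prod T n) (@prod_of_tuple T n).
Proof. by move=> [x t]; congr pair; apply/val_inj. Qed.

Lemma measurable_tuple_of_prod d (T : measurableType d) (n : nat) :
  measurable_fun [set: T * n.-tuple T] (@tuple_of_prod T n).
Proof. exact: measurable_cons. Qed.

Lemma measurable_prod_of_tuple d (T : measurableType d) (n : nat) :
  measurable_fun [set: n.+1.-tuple T] (@prod_of_tuple T n).
Proof.
apply/measurable_fun_pairP; split.
  exact: (measurable_tnth ord0).
exact: measurable_behead.
Qed.

(* One step of the construction of Lebesgue measure on n.-tuple R: the product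
   of Lebesgue measure on R with m, carried over to tuples. *)
Section lebesgue_product.
Context (R : realType) (n : nat).
Local Notation RT := (measurableTypeR R).
Variable m : {sigma_finite_measure set (n.-tuple RT) -> \bar R}.
Local Open Scope ereal_scope.

Definition lebesgue_product (A : set (n.+1.-tuple RT)) : \bar R :=
  ((@lebesgue_measure R) \x m) (@tuple_of_prod RT n @^-1` A).

Let lebesgue_product0 : lebesgue_product set0 = 0.
Proof. by rewrite /lebesgue_product preimage_set0 measure0. Qed.

Let lebesgue_product_ge0 A : 0 <= lebesgue_product A.
Proof. by apply: integral_ge0 => x _; exact: measure_ge0. Qed.

Let lebesgue_product_sigma_additive : semi_sigma_additive lebesgue_product.
Proof.
move=> F mF tF mUF; rewrite /lebesgue_product preimage_bigcup.
have mpre A : measurable A -> measurable (@tuple_of_prod RT n @^-1` A).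
  by move=> mA; rewrite -[X in measurable X]setTI; exact: measurable_tuple_of_prod.
apply: measure_semi_sigma_additive.
- by move=> k; exact: mpre.
- apply/trivIsetP => /= i j _ _ ij; rewrite -preimage_setI.
  by move/trivIsetP : tF => /(_ _ _ _ _ ij) ->//; rewrite preimage_set0.
- by rewrite -preimage_bigcup; exact: mpre.
Qed.

HB.instance Definition _ := isMeasure.Build _ _ _ lebesgue_product
  lebesgue_product0 lebesgue_product_ge0 lebesgue_product_sigma_additive.

Let lebesgue_product_sigma_finite : sigma_finite setT lebesgue_product.
Proof.
have /sigma_finiteP[F [TF ndF Foo]] := sigma_finiteT (@lebesgue_measure R).
have /sigma_finiteP[G [TG ndG Goo]] := sigma_finiteT m.
exists (fun k => @prod_of_tuple RT n @^-1` (F k `*` G k)).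
  apply/seteqP; split => // t _.
  have [k _ Fk] : (\bigcup_k F k) (thead t) by rewrite -TF.
  have [l _ Gl] : (\bigcup_k G k) [tuple of behead t] by rewrite -TG.
  exists (maxn k l) => //; split => /=.
  - by move: Fk; exact/subsetPset/ndF/leq_maxl.
  - by move: Gl; exact/subsetPset/ndG/leq_maxr.
move=> k; have [mF Fk] := Foo k; have [mG Gk] := Goo k; split.
  by rewrite -[X in measurable X]setTI; apply: measurable_prod_of_tuple => //;
    exact: measurableX.
rewrite /lebesgue_product (_ : _ @^-1` _ = F k `*` G k); last first.
  by apply/funext => p; exact: (congr1 (F k `*` G k) (tuple_of_prodK p)).
by rewrite product_measure1E// lte_mul_pinfty// ge0_fin_numE.
Qed.

HB.instance Definition _ := Measure_isSigmaFinite.Build _ _ _ lebesgue_product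
  lebesgue_product_sigma_finite.

End lebesgue_product.

Fixpoint lebesgue_measure_tuple (R : realType) (n : nat) :
    {sigma_finite_measure set (n.-tuple (measurableTypeR R)) -> \bar R} :=
  if n is k.+1 then lebesgue_product (lebesgue_measure_tuple R k)
  else \d_ [tuple].

Lemma lebesgue_measure_tuple_box (R : realType) (n : nat)
    (A : 'I_n -> set (measurableTypeR R)) :
  (forall i, measurable (A i)) ->
  (lebesgue_measure_tuple R n [set t | forall i, A i (tnth t i)] =
   \prod_(i < n) lebesgue_measure (A i))%E.
Proof.
elim: n A => [|n IHn] A mA.
  rewrite big_ord0 /= diracE mem_set//; by case.
rewrite big_ord_recl/= /lebesgue_product.
pose B := [set t : n.-tuple (measurableTypeR R)
          | forall i, A (lift ord0 i) (tnth t i)].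
have mB : measurable B.
  rewrite (_ : B = \bigcap_(i in [set: 'I_n])
      ((fun t => tnth t i) @^-1` A (lift ord0 i))).
    apply: fin_bigcap_measurable => // i _.
    by rewrite -[X in measurable X]setTI; exact: measurable_tnth.
  by apply/seteqP; split => [t Bt i _|t Bt i]; exact: Bt.
rewrite (_ : _ @^-1` _ = A ord0 `*` B); last first.
  apply/seteqP; split => [[x t] /= Axt|[x t] [/= Ax Bt] i].
    split=> /= [|i]; first exact: (Axt ord0).
    by have := Axt (lift ord0 i); rewrite tnthS.
  have [j ->|->] := unliftP ord0 i; last exact: Ax.
  by rewrite tnthS; exact: Bt.
rewrite product_measure1E//; congr (_ * _)%E.
by apply: (IHn (fun i => A (lift ord0 i))) => i; exact: mA.
Qed.

Section ellipsoids.
Context (R : realType) (n : nat).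
Implicit Types (x y c : 'cV[R]_n) (X : 'M[R]_n) (K E A : set 'cV[R]_n).

Definition volume A : \bar R :=
  lebesgue_measure_tuple R n [set t | A (\col_i tnth t i)].

Definition dot x y : R := \sum_i x i 0 * y i 0.

(* `|x| is the max norm in the library. *)
Definition enorm x : R := Num.sqrt (dot x x).

Definition posdefmx X : Prop :=
  X^T = X /\ forall x, x != 0 -> 0 < dot (X *m x) x.

Definition ellipsoid X c : set 'cV[R]_n :=
  [set x | dot (X *m (x - c)) (x - c) <= 1].

Definition is_ellipsoid E : Prop :=
  exists X c, posdefmx X /\ E = ellipsoid X c.

Definition min_volume_circumscribed K E : Prop :=
  [/\ is_ellipsoid E, K `<=` E &
    forall E', is_ellipsoid E' -> K `<=` E' -> (volume E <= volume E')%E].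

(* E = CE(K): the minimum is attained at E and only there. *)
Definition is_CE K E : Prop := unique (min_volume_circumscribed K) E.

(* The first coordinate is the one of index 0. *)
Definition e1 : 'cV[R]_n := \col_i (i == 0%N :> nat)%:R.

Definition diag_ab (a b : R) : 'M[R]_n :=
  diag_mx (\row_i if i == 0%N :> nat then a else b).

Definition ball_slab (alpha beta : R) : set 'cV[R]_n :=
  [set x | enorm x <= 1 /\
           forall i : 'I_n, i = 0%N :> nat -> alpha <= x i 0 <= beta].

End ellipsoids.

Arguments e1 {R n}.
Arguments diag_ab {R n} a b.
Arguments ball_slab {R n} alpha beta.

(* Main.v *)
Require Import Defs.
From mathcomp Require Import all_boot all_order all_algebra.
From mathcomp Require Import all_classical all_reals all_analysis.
From mathcomp Require Import measurable_realfun ring lra.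

(* Write Q for the quadratic form of a positive definite X. Slicing along the
   first coordinate and completing the square (Schur complement) gives, by
   induction on the dimension, vol {Q(x - c) <= r} = det(X)^(-1/2) V_n(r), so
   minimizing the volume means maximizing det X.

   If E(X, c) contains the body, it contains the points
   (s, 0, .., +-sqrt(1 - s^2), .., 0) for s = alpha', beta' in [alpha, beta].
   Averaging Q(x - c) <= 1 over them, with weights on alpha' and beta' whose
   barycenter is tau, bounds Q(c - tau e1) plus a weighted trace of X. Then
   Hadamard's inequality det X <= prod X_ii and AM-GM bound det X, and equality
   forces X = diag(a, b, .., b) and c = tau e1. One takes alpha' = alpha and
   beta' = beta, except in case (i), where the slab is first shrunk until
   alpha' beta' = -1/n. *)

Set Implicit Arguments.
Unset Strict Implicit.
Unset Printing Implicit Defensive.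

Import Order.TTheory GRing.Theory Num.Theory.

Local Open Scope classical_set_scope.
Local Open Scope ring_scope.

(** * Iterated slices of the ball *)

Lemma measurable_affine (R : realType) (k c : R) :
  measurable_fun [set: measurableTypeR R]
    ((fun s => k * (s - c)) : _ -> measurableTypeR R).
Proof.
by apply: measurable_funM => //; exact: measurable_funB.
Qed.

(** The pushforward of Lebesgue measure under the affine map, scaled by [k], gives each interval
    []a, b]] its length, and this determines Lebesgue measure. *)
Lemma lebesgue_measure_affine (R : realType) (k c : R) (A : set R) :
  0 < k -> measurable A ->
  lebesgue_measure A =
  (k%:E * lebesgue_measure ((fun s : R => (k * (s - c))%R) @^-1` A))%E.
Proof.
move=> k0 mA.
pose g : measurableTypeR R -> measurableTypeR R := fun s => k * (s - c).
have mg : measurable_fun setT g by exact: measurable_affine.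
pose gmu : {measure set (measurableTypeR R) -> \bar R} :=
  pushforward lebesgue_measure g.
pose nu : {measure set (measurableTypeR R) -> \bar R} :=
  mscale (NngNum (ltW k0)) (gmu mg).
apply: (@lebesgue_measure_unique R nu) => // _ [[a b]] _ <-.
rewrite -[RHS]/(k%:E * lebesgue_measure (g @^-1` `]a, b]%classic))%E.
have -> : g @^-1` `]a, b]%classic = `]a / k + c, b / k + c]%classic.
  apply/seteqP; split => s /=; rewrite !in_itv/= /g;
    by rewrite -ltrBrDr -lerBlDr ltr_pdivrMr// ler_pdivlMr// mulrC.
rewrite !lebesgue_measure_itv/= !lte_fin ltrD2r ltr_pM2r ?invr_gt0//.
case: ifPn => _; last by rewrite mule0.
rewrite -!EFinB -EFinM; congr EFin.
by field; exact: lt0r_neq0.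
Qed.

Lemma ge0_integral_affine (R : realType) (k c : R) (f : R -> \bar R) :
  0 < k -> measurable_fun [set: R] f -> (forall s, (0 <= f s)%E) ->
  (\int[lebesgue_measure]_s f (k * (s - c))%R =
   k^-1%:E * \int[lebesgue_measure]_s f s)%E.
Proof.
move=> k0 mf f0.
pose g : measurableTypeR R -> measurableTypeR R := fun s => k * (s - c).
have mg : measurable_fun setT g by exact: measurable_affine.
pose gmu : {measure set (measurableTypeR R) -> \bar R} :=
  pushforward lebesgue_measure g.
pose nu : {measure set (measurableTypeR R) -> \bar R} :=
  mscale (NngNum (ltW k0)) (gmu mg).
have -> : (\int[lebesgue_measure]_s f s = \int[nu]_s f s)%E.
  apply: (@eq_measure_integral _ _ _ setT nu) => A mA _.
  exact: (lebesgue_measure_affine c k0).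
rewrite ge0_integral_mscale//= ge0_integral_pushforward//=.
by rewrite muleA -EFinM mulVf ?lt0r_neq0// mul1e.
Qed.

(** The preimage of an upper ray is upward closed, hence an interval. *)
Lemma nondecreasing_emeasurable (R : realType) (f : R -> \bar R) :
  {homo f : x y / x <= y >-> (x <= y)%E} -> measurable_fun [set: R] f.
Proof.
move=> f_nd.
apply: (measurability (@ErealGenCInfty.G R)) => [|/= _ [_] [r] -> <-].
  exact: ErealGenCInfty.measurableE.
apply: measurableI => //; apply: is_interval_measurable => s t/=.
rewrite !in_itv/= !andbT => fs ft u /andP[su ut].
by rewrite in_itv/= andbT (le_trans fs)// f_nd.
Qed.

(* The volume of [{x | |x|^2 <= r}] in dimension n, sliced by the first
   coordinate. *)
Fixpoint ball_volume (R : realType) (n : nat) (r : R) : \bar R :=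
  if n is k.+1 then (\int[lebesgue_measure]_s ball_volume k (r - s ^+ 2)%R)%E
  else (0 <= r)%R%:R%:E.

Section ball_volume.
Context {R : realType}.
Local Open Scope ereal_scope.
Local Notation V := (@ball_volume R).

Lemma ball_volume_ge0 n r : 0 <= V n r.
Proof.
elim: n r => [|n IHn] r /=; first by rewrite lee_fin.
by apply: integral_ge0 => s _.
Qed.

(** Monotonicity is a hypothesis here because [ball_volume_le] calls this lemma within its own
    induction. *)
Lemma measurable_ball_volume_step n r :
  {homo V n : x y / (x <= y)%R >-> x <= y} ->
  measurable_fun [set: R] (fun s : R => V n (r - s ^+ 2)%R).
Proof.
move=> /nondecreasing_emeasurable mV.
apply: (measurableT_comp mV).
by apply: measurable_funB => //; exact: measurable_funX.
Qed.

Lemma ball_volume_le n : {homo V n : x y / (x <= y)%R >-> x <= y}.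
Proof.
elim: n => [|n IHn] x y xy /=.
  by rewrite lee_fin ler_nat; case: (leP 0%R x) => // /le_trans/(_ xy) ->.
apply: ge0_le_integral => //.
- by move=> s _; exact: ball_volume_ge0.
- exact: measurable_ball_volume_step.
- exact: measurable_ball_volume_step.
- by move=> s _; apply: IHn; exact: lerB.
Qed.

Lemma ball_volume_lt0 n r : (r < 0)%R -> V n r = 0.
Proof.
elim: n r => [|n IHn] r r0 /=; first by rewrite leNgt r0.
apply: integral0_eq => s _; apply: IHn.
by rewrite subr_lt0 (lt_le_trans r0)// sqr_ge0.
Qed.

Lemma ball_volume_gt0 n r : (0 < r)%R -> 0 < V n r.
Proof.
elim: n r => [|n IHn] r r0 /=; first by rewrite ltW//= lte_fin.
(* On [[0, k]] the bound 1 gives [s ^+ 2 <= s], and the bound [r / 2] then keeps the level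
   [r - s ^+ 2] at least [r / 2]. *)
pose k := Num.min 1%R (r / 2)%R.
have k0 : (0 < k)%R by rewrite lt_min ltr01 divr_gt0.
have mV := measurable_ball_volume_step r (@ball_volume_le n).
apply: (@lt_le_trans _ _ (\int[lebesgue_measure]_(s in `[0%R, k]) V n (r / 2)%R)).
  rewrite integral_cst//= lebesgue_measure_itv/= lte_fin k0.
  by rewrite oppr0 adde0 mule_gt0// IHn// divr_gt0.
apply: (@le_trans _ _ (\int[lebesgue_measure]_(s in `[0%R, k]) V n (r - s ^+ 2)%R)).
  apply: ge0_le_integral => //.
  - by move=> s _; exact: ball_volume_ge0.
  - exact: measurable_funS mV.
  - move=> s /=; rewrite in_itv/= le_min => /and3P[s0 s1 sr].
    apply: ball_volume_le; have : (s ^+ 2 <= s)%R by rewrite expr2 ler_piMl.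
    lra.
by apply: ge0_subset_integral => // s _; exact: ball_volume_ge0.
Qed.

Lemma ball_volume_lty n r : V n r < +oo.
Proof.
elim: n r => [|n IHn] r /=; first by rewrite ltry.
have mV := measurable_ball_volume_step r (@ball_volume_le n).
(* Once the absolute value of [s] exceeds [k], [s ^+ 2] exceeds [r], so the slice has negative level
   and zero volume. *)
pose k := (1 + `|r|)%R.
apply: (@le_lt_trans _ _ (\int[lebesgue_measure]_(s in `[(- k)%R, k]) V n r)).
  rewrite [leLHS](_ : _ =
    \int[lebesgue_measure]_(s in `[(- k)%R, k]) V n (r - s ^+ 2)%R).
    apply: ge0_le_integral => //.
    - by move=> s _; exact: ball_volume_ge0.
    - exact: measurable_funS mV.
    - by move=> s _; apply: ball_volume_le; rewrite gerBl sqr_ge0.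
  rewrite [RHS]integral_mkcond; apply: eq_integral => s _.
  rewrite patchE; case: ifPn => //; rewrite notin_setE/= in_itv/= => sk.
  apply: ball_volume_lt0.
  have {}sk : (k < `|s|)%R by rewrite ltNge ler_norml; exact/negP.
  rewrite -real_normK ?num_real// subr_lt0.
  apply: (le_lt_trans (ler_norm r)).
  have := normr_ge0 r; rewrite /k in sk; nra.
rewrite integral_cst//= lte_mul_pinfty ?ball_volume_ge0//.
  by rewrite fin_numElt IHn (lt_le_trans _ (ball_volume_ge0 _ _)).
by rewrite lebesgue_measure_itv/=; case: ifPn => // _; rewrite -EFinB ltry.
Qed.

Lemma ball_volume_fin_num n r : V n r \is a fin_num.
Proof. by rewrite ge0_fin_numE ?ball_volume_lty// ball_volume_ge0. Qed.

(** The substitution [Num.sqrt b * (s - c)] reduces this to the defining integral of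
    [ball_volume n.+1]. *)
Lemma ball_volume_slice n (b c r : R) : (0 < b)%R ->
  \int[lebesgue_measure]_s V n (r - b * (s - c) ^+ 2)%R =
  ((Num.sqrt b)^-1)%:E * V n.+1 r.
Proof.
move=> b0 /=.
rewrite -(@ge0_integral_affine R (Num.sqrt b) c
    (fun s => V n (r - s ^+ 2)%R)) ?sqrtr_gt0//.
- apply: eq_integral => s _; congr (V n _).
  by rewrite exprMn sqr_sqrtr ?ltW.
- by apply: measurable_ball_volume_step; exact: ball_volume_le.
- by move=> s; exact: ball_volume_ge0.
Qed.

End ball_volume.

(** * Schur complements and Hadamard's inequality *)

Section dot.
Context {R : realType}.

Lemma dotE n (x y : 'cV[R]_n) : dot x y = (x^T *m y) 0 0.
Proof. by rewrite /dot mxE; apply: eq_bigr => i _; rewrite mxE. Qed.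

Lemma dotC n (x y : 'cV[R]_n) : dot x y = dot y x.
Proof. by rewrite /dot; apply: eq_bigr => i _; rewrite mulrC. Qed.

Lemma dotDl n (x y z : 'cV[R]_n) : dot (x + y) z = dot x z + dot y z.
Proof. by rewrite !dotE raddfD/= mulmxDl mxE. Qed.

Lemma dotDr n (x y z : 'cV[R]_n) : dot z (x + y) = dot z x + dot z y.
Proof. by rewrite !dotE mulmxDr mxE. Qed.

Lemma dotZl n (k : R) (x y : 'cV[R]_n) : dot (k *: x) y = k * dot x y.
Proof. by rewrite !dotE linearZ/= -scalemxAl mxE. Qed.

Lemma dotZr n (k : R) (x y : 'cV[R]_n) : dot x (k *: y) = k * dot x y.
Proof. by rewrite dotC dotZl dotC. Qed.

Lemma dot0r n (x : 'cV[R]_n) : dot x 0 = 0.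
Proof. by rewrite dotE mulmx0 mxE. Qed.

Lemma dot_mulmxl n m (A : 'M[R]_(m, n)) (x : 'cV[R]_n) (y : 'cV[R]_m) :
  dot (A *m x) y = dot x (A^T *m y).
Proof. by rewrite !dotE trmx_mul mulmxA. Qed.

Lemma dot_col_mx n (u u' : 'cV[R]_1) (z z' : 'cV[R]_n) :
  dot (col_mx u z) (col_mx u' z') = u 0 0 * u' 0 0 + dot z z'.
Proof. by rewrite !dotE tr_col_mx mul_row_col mxE; congr (_ + _); rewrite mxE big_ord1 mxE. Qed.

End dot.

Section posdef.
Context {R : realType}.

Lemma posdefmx_ge0 n (X : 'M[R]_n) (x : 'cV[R]_n) :
  posdefmx X -> 0 <= dot (X *m x) x.
Proof.
move=> [_ X0]; have [->|/X0/ltW//] := eqVneq x 0.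
by rewrite dot0r.
Qed.

Lemma posdefmx_unit n (X : 'M[R]_n) : posdefmx X -> X \in unitmx.
Proof.
move=> [sX X0]; rewrite -row_free_unit; apply: inj_row_free => v vX.
apply/eqP; rewrite -trmx_eq0; apply/negPn/negP => /X0.
by rewrite -[X in X *m _]sX -trmx_mul vX trmx0 dotC dot0r ltxx.
Qed.

Lemma quadratic_delta n (X : 'M[R]_n) i :
  dot (X *m delta_mx i 0) (delta_mx i 0) = X i i.
Proof.
by rewrite -colE dotC dotE trmx_delta -rowE !mxE.
Qed.

Lemma posdefmx_diag_gt0 n (X : 'M[R]_n) i : posdefmx X -> 0 < X i i.
Proof.
move=> [_ X0]; rewrite -quadratic_delta; apply: X0; apply/eqP => /matrixP/(_ i 0).
by rewrite !mxE !eqxx => /eqP; rewrite oner_eq0.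
Qed.

(** For a fixed first coordinate [s], the quadratic form of a positive definite [X] is least when
    the other coordinates are [- s] times this vector. *)
Definition schur_shift n (X : 'M[R]_(1 + n)) : 'cV[R]_n :=
  invmx (drsubmx X) *m dlsubmx X.

(** For positive definite [X] with first column [(x, v)] and lower block [Y], this is the usual
    [x - v^T Y^-1 v]; the subtracted term is visibly a value of the form of [Y]. *)
Definition schur_compl n (X : 'M[R]_(1 + n)) : R :=
  X 0 0 - dot (drsubmx X *m schur_shift X) (schur_shift X).

Lemma posdefmx_drsub n (X : 'M[R]_(1 + n)) : posdefmx X -> posdefmx (drsubmx X).
Proof.
move=> [sX X0]; split; first by rewrite trmx_drsub sX.
move=> x x0; have := X0 (col_mx 0 x).
rewrite -{1}[X]submxK mul_block_col !mulmx0 !add0r dot_col_mx [X in _ * X]mxE mulr0 add0r.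
by apply; rewrite col_mx_eq0 eqxx.
Qed.

Variables (n : nat) (X : 'M[R]_(1 + n)).
Hypothesis pX : posdefmx X.
Local Notation Y := (drsubmx X).
Local Notation w := (schur_shift X).

Lemma schur_shiftE : dlsubmx X = Y *m w.
Proof. by rewrite mulmxA mulmxV ?mul1mx//; exact/posdefmx_unit/posdefmx_drsub. Qed.

Let ursubE : ursubmx X = w^T *m Y.
Proof.
have [sY _] := posdefmx_drsub pX.
rewrite -[Y in RHS]sY -(trmx_mul Y) -schur_shiftE trmx_dlsub.
by case: pX => ->.
Qed.

Let ulsubE : ulsubmx X = (schur_compl X)%:M + w^T *m Y *m w.
Proof.
apply/matrixP => i j; rewrite !ord1 /schur_compl !mxE/= mulr1n.
have -> : lshift n (0 : 'I_1) = 0 by exact: val_inj.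
rewrite dotC dotE mulmxA !mxE; lra.
Qed.

(** Completing the square: the cross terms in [s] and [z] are absorbed by the shift of [z]. *)
Lemma schur_quadratic s z :
  dot (X *m col_mx s%:M z) (col_mx s%:M z) =
  schur_compl X * s ^+ 2 + dot (Y *m (z + s *: w)) (z + s *: w).
Proof.
have [sY _] := posdefmx_drsub pX.
have wYE u : (w^T *m Y *m u) 0 0 = dot (Y *m w) u.
  by rewrite dotE (trmx_mul Y) sY.
have YC u v : dot (Y *m u) v = dot (Y *m v) u by rewrite dot_mulmxl sY dotC.
rewrite -{1}[X]submxK mul_block_col dot_col_mx ulsubE ursubE schur_shiftE.
rewrite !mul_mx_scalar [X in X * _]mxE wYE [X in (X + _) * _]mxE.
rewrite [X in s * X]mxE wYE !mxE/= !mulr1n.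
rewrite mulmxDr -scalemxAr !dotDl !dotDr !dotZl !dotZr (YC z w).
by ring.
Qed.

(** The test vector [(1, - w)] annihilates the square in [schur_quadratic]. *)
Lemma schur_compl_gt0 : 0 < schur_compl X.
Proof.
have [_ /(_ (col_mx 1%:M (- w)))] := pX.
rewrite schur_quadratic scale1r addNr dot0r addr0 expr1n mulr1.
by apply; rewrite col_mx_eq0 negb_and (oner_neq0 'M[R]_1).
Qed.

(** Right multiplication by a unipotent block matrix clears the lower left block of [X] and leaves
    the Schur complement in the corner. *)
Lemma det_schur : \det X = schur_compl X * \det Y.
Proof.
have : \det (X *m block_mx 1%:M 0 (- w) 1%:M) = schur_compl X * \det Y.
  rewrite -{1}[X]submxK mulmx_block !mulmx1 !mulmx0 !add0r !mulmxN -schur_shiftE.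
  rewrite subrr det_ublock ulsubE ursubE addrK.
  by rewrite det_scalar1.
by rewrite det_mulmx det_lblock !det1 !mulr1.
Qed.

End posdef.

Section hadamard.
Context {R : realType}.

Lemma posdefmx_det_gt0 n (X : 'M[R]_n) : posdefmx X -> 0 < \det X.
Proof.
elim: n X => [|n IHn] X pX; first by rewrite det_mx00.
rewrite (@det_schur _ n)// mulr_gt0 ?(@schur_compl_gt0 _ n)//.
exact/IHn/(@posdefmx_drsub _ n).
Qed.

(** Induction through [det_schur]: the corner entry exceeds the Schur complement by the form of the
    lower block at [w]. Equality forces [w = 0], which clears the first column below the corner,
    together with equality for the lower block. *)
Lemma hadamard_det n (X : 'M[R]_n) : posdefmx X ->
  \det X <= \prod_i X i i ?= iff is_diag_mx X.
Proof.
elim: n X => [|n IHn] X pX.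
  rewrite det_mx00 big_ord0; split=> //; rewrite eqxx.
  by apply/esym/is_diag_mxP; case.
have pY := @posdefmx_drsub _ n _ pX.
have [le_det eq_det] := IHn _ pY.
rewrite big_ord_recl (@det_schur _ n)//.
have drE i j : @drsubmx _ 1 n 1 n X i j = X (lift ord0 i) (lift ord0 j).
  by rewrite !mxE !rshift1.
have prodE : \prod_(i < n) X (lift ord0 i) (lift ord0 i) =
    \prod_(i < n) @drsubmx _ 1 n 1 n X i i.
  by apply: eq_bigr => i _; rewrite drE.
rewrite prodE.
have s0 : 0 < @schur_compl _ n X by exact: (@schur_compl_gt0 _ n).
have d0 := posdefmx_det_gt0 pY.
set w := @schur_shift _ n X.
have XE : X ord0 ord0 = @schur_compl _ n X + dot (@drsubmx _ 1 n 1 n X *m w) w.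
  by rewrite /schur_compl subrK.
have q0 := posdefmx_ge0 w pY.
have sX : @schur_compl _ n X <= X ord0 ord0 by rewrite XE lerDl.
split; first by rewrite ler_pM// ltW.
apply/eqP/idP => [detE|dX]; last first.
  have w0 : w = 0.
    suff v0 : @dlsubmx _ 1 n 1 n X = 0 by rewrite /w /schur_shift v0 mulmx0.
    apply/matrixP => i j; rewrite !mxE ord1.
    by move/is_diag_mxP: dX => ->.
  rewrite XE w0 dot0r addr0; congr (_ * _); apply/eqP; rewrite eq_det.
  apply/is_diag_mxP => i j ij; rewrite drE; move/is_diag_mxP: dX => -> //.
have qE : dot (@drsubmx _ 1 n 1 n X *m w) w = 0 by rewrite XE in detE; nra.
have dE : \det (@drsubmx _ 1 n 1 n X) = \prod_(i < n) @drsubmx _ 1 n 1 n X i i.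
  by move: detE; rewrite XE qE addr0 => /mulfI; apply; rewrite gt_eqF.
have w0 : w = 0.
  by apply/eqP/negPn/negP; case: pY => _ Y0 /Y0; rewrite qE ltxx.
have v0 : @dlsubmx _ 1 n 1 n X = 0 by rewrite (@schur_shiftE _ n)// -/w w0 mulmx0.
move/eqP: dE; rewrite eq_det => /is_diag_mxP dY.
have X0 i : X (lift ord0 i) ord0 = 0.
  move/matrixP: v0 => /(_ i ord0); rewrite !mxE rshift1 => <-; congr (X _ _).
  exact: val_inj.
have sXE i j : X i j = X j i by case: pX => {2}<- _; rewrite mxE.
apply/is_diag_mxP => i j.
have [i' ->|->] := unliftP ord0 i; have [j' ->|->] := unliftP ord0 j => //.
- by move=> ij; rewrite -drE; apply: dY.
- by rewrite sXE.
Qed.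

End hadamard.

(** * Volumes and determinants *)

(** Level and center are arbitrary for the sake of the induction: the slice at [s] is a sublevel set
    for the lower block, with level lowered by [d * (s - c ord0 ord0) ^+ 2] and center moved along
    [w]. *)
Lemma volume_quadratic (R : realType) n (X : 'M[R]_n) (c : 'cV[R]_n) (r : R) :
  posdefmx X ->
  volume [set x | dot (X *m (x - c)) (x - c) <= r] =
  ((Num.sqrt (\det X))^-1%:E * ball_volume n r)%E.
Proof.
elim: n X c r => [|n IHn] X c r pX.
  rewrite det_mx00 sqrtr1 invr1 mul1e /volume /= diracE.
  congr (_%:R)%:E; congr nat_of_bool.
  by apply/idP/idP; rewrite inE /= /dot big_ord0.
set Y := @drsubmx _ 1 n 1 n X; set w := @schur_shift _ n X.
set d := @schur_compl _ n X.
have pY : posdefmx Y by exact: (@posdefmx_drsub _ n).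
have d0 : 0 < d by exact: (@schur_compl_gt0 _ n).
pose c' := @dsubmx _ 1 n 1 c.
transitivity (\int[lebesgue_measure]_s
    ((Num.sqrt (\det Y))^-1%:E * ball_volume n (r - d * (s - c ord0 ord0) ^+ 2)%R))%E.
  apply: eq_integral => s _; rewrite -(IHn _ (c' - (s - c ord0 ord0) *: w))//=.
  congr (lebesgue_measure_tuple _ _ _).
  have xE (t : n.-tuple R) : \col_i tnth [tuple of s :: t] i - c =
      col_mx (s - c ord0 ord0)%:M (\col_i tnth t i - c') :> 'cV_(1 + n).
    apply/matrixP => i j; rewrite !mxE [j]ord1.
    case: splitP => k ik; rewrite !mxE.
      rewrite [k]ord1 in ik *; rewrite (_ : i = ord0) ?mulr1n//; exact: val_inj.
    rewrite (_ : i = lift ord0 k) ?tnthS ?rshift1//; exact: val_inj.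
  have qE (t : n.-tuple R) (x := \col_i tnth [tuple of s :: t] i - c)
      (z := \col_i tnth t i - (c' - (s - c ord0 ord0) *: w)) :
      dot (X *m x) x = d * (s - c ord0 ord0) ^+ 2 + dot (Y *m z) z.
    by rewrite /x xE (@schur_quadratic _ n)// /z opprB addrCA addrC.
  by apply/seteqP; split => t; rewrite /xsection /= inE /= qE lerBrDl.
have mV := measurable_ball_volume_step r (@ball_volume_le R n).
rewrite ge0_integralZl//.
- by rewrite ball_volume_slice// muleA -EFinM (@det_schur _ n)// sqrtrM ?ltW// invfM mulrC.
- apply: (measurableT_comp (nondecreasing_emeasurable (@ball_volume_le R n))).
  apply: measurable_funB => //; apply: measurable_funM => //.
  by apply: measurable_funX; exact: measurable_funB.
- by move=> s _; exact: ball_volume_ge0.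
Qed.

Lemma volume_ellipsoid_le (R : realType) n (X X' : 'M[R]_n) (c c' : 'cV[R]_n) :
  posdefmx X -> posdefmx X' ->
  (volume (ellipsoid X c) <= volume (ellipsoid X' c'))%E = (\det X' <= \det X).
Proof.
move=> pX pX'; rewrite !volume_quadratic//.
rewrite lee_pmul2r ?ball_volume_fin_num ?ball_volume_gt0//.
have dX := posdefmx_det_gt0 pX; have dX' := posdefmx_det_gt0 pX'.
by rewrite lee_fin lef_pV2 ?posrE ?sqrtr_gt0// ler_sqrt// ltW.
Qed.

(** The form at [y] is nonnegative, so the ratios [z i = X i i / d 0 i] have mean at most 1. AM-GM
    bounds their product by 1, and Hadamard passes from the diagonal to the determinant. The second
    conclusion follows the equality cases back. *)
Lemma john_det_bound (R : realType) n (X : 'M[R]_n) (d : 'rV[R]_n) (y : 'cV[R]_n) :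
  (0 < n)%N -> posdefmx X -> (forall i, 0 < d 0 i) ->
  dot (X *m y) y + (\sum_i X i i / d 0 i) / n%:R <= 1 ->
  \det X <= \prod_i d 0 i /\
  (\prod_i d 0 i <= \det X -> y = 0 /\ X = diag_mx d).
Proof.
move=> n0 pX d0 XS.
have n0R : 0 < n%:R :> R by rewrite ltr0n.
pose z i := X i i / d 0 i.
have z0 i : 0 < z i by rewrite divr_gt0// posdefmx_diag_gt0.
have q0 := posdefmx_ge0 y pX.
have [h1 h2] := hadamard_det pX.
have prodE : \prod_i X i i = (\prod_i z i) * \prod_i d 0 i.
  by rewrite -big_split/=; apply: eq_bigr => i _; rewrite divfK// gt_eqF.
have pd0 : 0 < \prod_i d 0 i by apply: prodr_gt0 => i _.
have [] := @leif_AGM R 'I_n 'I_n z (fun i _ => ltW (z0 i)).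
rewrite card_ord; set mu := _ / _ => a1 a2.
have mu0 : 0 <= mu by rewrite divr_ge0// sumr_ge0// => i _; rewrite ltW.
have mu1 : mu <= 1 by rewrite /mu /z; lra.
have mun1 : mu ^+ n <= 1 by rewrite exprn_ile1.
have pz1 : \prod_i z i <= 1 by exact: le_trans a1 _.
have pdX : \prod_i X i i <= \prod_i d 0 i by rewrite prodE ler_piMl// ltW.
split; first exact: le_trans pdX.
move=> dX.
have XdE : \prod_i X i i = \prod_i d 0 i.
  by apply/eqP; rewrite eq_le pdX (le_trans dX).
have /is_diag_mxP Xdiag : is_diag_mx X by rewrite -h2 eq_le h1 XdE.
have zE : \prod_i z i = 1.
  by move: XdE; rewrite prodE -[RHS]mul1r => /mulIf; apply; rewrite gt_eqF.
have munE : mu ^+ n = 1 by apply/eqP; rewrite eq_le mun1 -zE.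
have muE : mu = 1.
  by apply/eqP; move/eqP: munE; rewrite pexpr_eq1.
(* A mean equal to 1 exhausts the hypothesis, so the form at [y] cannot be positive. *)
have yE : y = 0.
  apply/eqP/negPn/negP; case: pX => _ X0 /X0; move: muE XS; rewrite /mu /z; lra.
split=> //; apply/matrixP => i j; rewrite mxE; have [<-|ij] := eqVneq i j; last first.
  by rewrite Xdiag.
(* Equality in AM-GM makes all ratios equal, hence equal to their mean. *)
have zc k : z k = z i.
  move: a2; rewrite zE munE eqxx => /esym/'forall_forallP/(_ k i) /eqP//.
have : z i = 1.
  move: muE; rewrite /mu (eq_bigr (fun=> z i))// sumr_const card_ord.
  by rewrite -[X in X / _]mulr_natr mulfK ?gt_eqF.
by rewrite /z mulr1n => /(congr1 (fun u => u * d 0 i)); rewrite divfK ?mul1r ?gt_eqF.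
Qed.

(** * Contact points *)

Section diagonal_ellipsoid.
Context {R : realType}.

Lemma dot_diag_mx n (d : 'rV[R]_n) (x : 'cV[R]_n) :
  dot (diag_mx d *m x) x = \sum_i d 0 i * x i 0 ^+ 2.
Proof.
by apply: eq_bigr => i _; rewrite mul_diag_mx mxE expr2 mulrA.
Qed.

Lemma posdefmx_diag_mx n (d : 'rV[R]_n) :
  (forall i, 0 < d 0 i) -> posdefmx (diag_mx d).
Proof.
move=> d0; split; first exact: tr_diag_mx.
move=> x x0; rewrite dot_diag_mx lt_def sumr_ge0 ?andbT; last first.
  by move=> i _; rewrite mulr_ge0 ?sqr_ge0// ltW.
apply: contra_neq x0 => /psumr_eq0P s0; apply/matrixP => i j.
rewrite ord1 mxE; apply/eqP; rewrite -sqrf_eq0.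
have /eqP := s0 (fun i _ => mulr_ge0 (ltW (d0 i)) (sqr_ge0 _)) i isT.
by rewrite mulf_eq0 gt_eqF.
Qed.

Lemma e1E n : e1 = delta_mx 0 0 :> 'cV[R]_n.+1.
Proof. by apply/matrixP => i j; rewrite !mxE ord1 eqxx andbT. Qed.

Lemma ball_slab_sub_ellipsoid n (alpha beta a b tau : R) : 0 <= b ->
  (forall s, alpha <= s <= beta -> a * (s - tau) ^+ 2 + b * (1 - s ^+ 2) <= 1) ->
  @ball_slab R n.+1 alpha beta `<=` ellipsoid (diag_ab a b) (tau *: e1).
Proof.
move=> b0 f1 x [x1 /(_ ord0 erefl) /f1 fx].
rewrite /ellipsoid/= dot_diag_mx big_ord_recl !mxE/= mulr1.
have {}x1 : x ord0 0 ^+ 2 + \sum_(i < n) x (lift ord0 i) 0 ^+ 2 <= 1.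
  have := x1; rewrite /enorm -[X in _ <= X]sqrtr1 ler_sqrt// /dot big_ord_recl -expr2.
  by under eq_bigr do rewrite -expr2.
under eq_bigr do rewrite !mxE/= mulr0 subr0.
rewrite -mulr_sumr; set S := \sum_(i < n) _ in x1 *.
nra.
Qed.

Lemma quadratic_parallelogram n (X : 'M[R]_n) (u v : 'cV[R]_n) :
  dot (X *m (u + v)) (u + v) + dot (X *m (u - v)) (u - v) =
  2 * (dot (X *m u) u + dot (X *m v) v).
Proof.
rewrite -scaleN1r !mulmxDr !dotDl !dotDr -!scalemxAr !dotZl !dotZr.
by ring.
Qed.

Lemma dot_delta n (i j : 'I_n) :
  dot (delta_mx i 0) (delta_mx j 0 : 'cV[R]_n) = (i == j)%:R.
Proof. by rewrite dotE trmx_delta -rowE !mxE eqxx andbT eq_sym. Qed.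

Lemma ball_slab_pole n (alpha beta s r : R) (j : 'I_n) :
  alpha <= s <= beta -> s ^+ 2 + r ^+ 2 = 1 ->
  ball_slab alpha beta (s *: delta_mx ord0 0 + r *: delta_mx (lift ord0 j) 0).
Proof.
move=> sab sr; split; last first.
  move=> i i0; rewrite (_ : i = ord0); last exact: val_inj.
  by rewrite !mxE/= mulr1 mulr0 addr0.
rewrite /enorm !dotDl !dotDr !dotZl !dotZr !dot_delta !eqxx/=.
by rewrite !mulr0 addr0 add0r !mulr1 -!expr2 sr sqrtr1.
Qed.

(** For each [j], averaging over the two poles [s *: e1] plus or minus [r] times the basis vector of
    [lift ord0 j] cancels the cross term by the parallelogram identity. The [n] resulting
    inequalities are summed. *)
Lemma contact_sphere_bound n (alpha beta s : R) (X : 'M[R]_n.+1) (c : 'cV[R]_n.+1) :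
  ball_slab alpha beta `<=` ellipsoid X c -> alpha <= s <= beta -> s ^+ 2 <= 1 ->
  n%:R * dot (X *m (s *: e1 - c)) (s *: e1 - c) +
    (1 - s ^+ 2) * \sum_(j < n) X (lift ord0 j) (lift ord0 j) <= n%:R.
Proof.
move=> KE sab s1; set q := dot _ _.
have H j : q + (1 - s ^+ 2) * X (lift ord0 j) (lift ord0 j) <= 1.
  pose r := Num.sqrt (1 - s ^+ 2).
  have r2 : r ^+ 2 = 1 - s ^+ 2 by rewrite sqr_sqrtr// subr_ge0.
  have sr k : k ^+ 2 = r ^+ 2 -> s ^+ 2 + k ^+ 2 = 1 by move=> ->; rewrite r2; ring.
  have := KE _ (ball_slab_pole j sab (sr r erefl)).
  have := KE _ (ball_slab_pole j sab (sr (- r) (sqrrN r))).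
  rewrite /ellipsoid/= scaleNr -e1E ![_ + _ - c]addrAC.
  set u := s *: e1 - c; set v := r *: _ => h1 h2.
  have := quadratic_parallelogram X u v.
  have -> : dot (X *m v) v = (1 - s ^+ 2) * X (lift ord0 j) (lift ord0 j).
    by rewrite /v -scalemxAr dotZl dotZr quadratic_delta mulrA -expr2 r2.
  rewrite -/q; lra.
have : \sum_(j < n) (q + (1 - s ^+ 2) * X (lift ord0 j) (lift ord0 j)) <= \sum_(j < n) 1.
  by apply: ler_sum => j _.
by rewrite big_split/= -mulr_sumr !sumr_const card_ord mulr_natl.
Qed.

(* The two equations on [a] and [b] say that the averaged contact inequality has
   weights [1 / (N a)] on [X 0 0] and [1 / (N b)] on the other diagonal entries,
   where [N = n + 1]. *)
Lemma lowner_ball_slab n (alpha beta alpha' beta' a b tau : R) :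
  (0 < n)%N -> -1 <= alpha -> beta <= 1 ->
  alpha <= alpha' -> alpha' < tau -> tau < beta' -> beta' <= beta ->
  0 < a -> 0 < b ->
  n.+1%:R * a * ((tau - alpha') * (beta' - tau)) = 1 ->
  n.+1%:R * b * (1 + alpha' * beta' - tau * (alpha' + beta')) = n%:R ->
  (forall s, alpha <= s <= beta -> a * (s - tau) ^+ 2 + b * (1 - s ^+ 2) <= 1) ->
  is_CE (@ball_slab R n.+1 alpha beta) (ellipsoid (diag_ab a b) (tau *: e1)).
Proof.
move=> n0 al1 be1 al' altau taube be' a0 b0 aE bE f1.
pose d : 'rV[R]_n.+1 := \row_i (if i == 0%N :> nat then a else b).
have d0 i : 0 < d 0 i by rewrite mxE; case: ifP.
have pD : posdefmx (diag_ab a b : 'M[R]_n.+1) by exact: (posdefmx_diag_mx d0).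
have KE : @ball_slab R n.+1 alpha beta `<=` ellipsoid (diag_ab a b) (tau *: e1).
  exact: ball_slab_sub_ellipsoid (ltW b0) f1.
have detD : \det (diag_ab a b : 'M[R]_n.+1) = \prod_i d 0 i by rewrite det_diag.
(* One bound on all circumscribed ellipsoids serves twice: its inequality gives minimality, its
   equality case uniqueness. *)
have bound (X : 'M[R]_n.+1) c : posdefmx X -> ball_slab alpha beta `<=` ellipsoid X c ->
    \det X <= \prod_i d 0 i /\
    (\prod_i d 0 i <= \det X -> c - tau *: e1 = 0 /\ X = diag_mx d).
  move=> pX KX; apply: john_det_bound => //.
  have sq1 s : alpha <= s <= beta -> s ^+ 2 <= 1.
    by move=> /andP[s1 s2]; nra.
  have al'I : alpha <= alpha' <= beta by lra.
  have be'I : alpha <= beta' <= beta by lra.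
  have := contact_sphere_bound KX al'I (sq1 _ al'I).
  have := contact_sphere_bound KX be'I (sq1 _ be'I).
  set y := c - tau *: e1.
  have qE s : dot (X *m (s *: e1 - c)) (s *: e1 - c) =
      (s - tau) ^+ 2 * X 0 0
      - (s - tau) * (dot (X *m e1) y + dot (X *m y) e1) + dot (X *m y) y.
    rewrite -quadratic_delta -e1E.
    rewrite (_ : s *: e1 - c = (s - tau) *: e1 + (-1) *: y); last first.
      by rewrite /y scalerBl scaleN1r opprB addrA addrNK.
    clearbody y; rewrite !mulmxDr !dotDl !dotDr -!scalemxAr !dotZl !dotZr.
    by ring.
  rewrite !qE big_ord_recl !mxE/=.
  set T := \sum_(j < n) X (lift ord0 j) (lift ord0 j).
  have -> : \sum_(i < n) X (lift ord0 i) (lift ord0 i) / d 0 (lift ord0 i) = T / b.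
    by rewrite /T mulr_suml; apply: eq_bigr => i _; rewrite mxE.
  set B := dot _ _ + dot _ _; set q := dot (X *m y) y; set x := X ord0 ord0.
  move=> h1 h2.
  have N0 : 0 < n%:R :> R by rewrite ltr0n.
  have N1 : 0 < n.+1%:R :> R by rewrite ltr0n.
  (* The two coefficients are the means of [(s - tau) ^+ 2] and, up to the factor [n], of
     [1 - s ^+ 2], for the weights on [alpha'] and [beta'] with barycenter [tau]. *)
  have -> : (x / a + T / b) / n.+1%:R =
      ((tau - alpha') * (beta' - tau)) * x
      + (1 + alpha' * beta' - tau * (alpha' + beta')) / n%:R * T.
    have -> : (tau - alpha') * (beta' - tau) = (n.+1%:R * a)^-1.
      apply: (mulfI (lt0r_neq0 (mulr_gt0 N1 a0))).
      by rewrite aE divff// gt_eqF// mulr_gt0.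
    have -> : 1 + alpha' * beta' - tau * (alpha' + beta') = n%:R / (n.+1%:R * b).
      by rewrite -bE mulrAC divff ?mul1r// gt_eqF// mulr_gt0.
    by field; rewrite !gt_eqF.
  rewrite -(ler_pM2l N0) -(@ler_pM2l _ (beta' - alpha')) ?subr_gt0 ?(lt_trans altau)//.
  (* The inequality at [beta'] gets weight [tau - alpha'] and the one at [alpha'] gets
     [beta' - tau]; the terms in [B] then cancel. *)
  have {}h1 := ler_wpM2l (ltW (_ : 0 < tau - alpha')) h1.
  have {}h2 := ler_wpM2l (ltW (_ : 0 < beta' - tau)) h2.
  have := lerD (h1 _) (h2 _); rewrite !subr_gt0 => /(_ altau taube) h.
  have -> : (beta' - alpha') * (n%:R * 1) = (tau - alpha') * n%:R + (beta' - tau) * n%:R.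
    by ring.
  apply: le_trans h; rewrite le_eqVlt; apply/orP; left; apply/eqP.
  by field; rewrite gt_eqF.
split.
  split=> //; first by exists (diag_ab a b), (tau *: e1).
  move=> _ [X [c [pX ->]]] /(bound _ _ pX)[Xd _].
  by rewrite volume_ellipsoid_le// detD.
move=> _ [[X [c [pX ->]]] /(bound _ _ pX)[_ Xd]].
move=> /(_ (ellipsoid (diag_ab a b) (tau *: e1))) => minX.
(* Comparing another minimizer with the explicit ellipsoid gives the reverse determinant
   inequality. *)
have [] := Xd.
  rewrite -detD -(volume_ellipsoid_le c (tau *: e1) pX pD); apply: minX => //.
  by exists (diag_ab a b), (tau *: e1).
by move=> /subr0_eq -> ->.
Qed.

End diagonal_ellipsoid.

(** * The parameters tau, a and b *)

Section parameters.
Context {R : realType}.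

(** After multiplication by [4 * A], negativity at [x] says that [(2 * A * x - B) ^+ 2] is below the
    discriminant, so [x] lies strictly between the roots. *)
Lemma smaller_root_lt (A B C x : R) : 0 < A -> A * x ^+ 2 - B * x + C < 0 ->
  (B - Num.sqrt (B ^+ 2 - 4 * A * C)) / (2 * A) < x.
Proof.
move=> A0 gx.
have D : (2 * A * x - B) ^+ 2 < B ^+ 2 - 4 * A * C by nra.
have D0 : 0 <= B ^+ 2 - 4 * A * C by rewrite (le_trans _ (ltW D))// sqr_ge0.
rewrite ltr_pdivrMr; last lra.
have := sqrtr_ge0 (B ^+ 2 - 4 * A * C); have := sqr_sqrtr D0.
by move: (Num.sqrt _) => r rD r0; rewrite -rD in D; nra.
Qed.

(** Here [x] lies outside the roots and [y] strictly between them; as [x < y], [x] is to the left of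
    both. *)
Lemma lt_smaller_root (A B C x y : R) : 0 < A -> x < y ->
  0 < A * x ^+ 2 - B * x + C -> A * y ^+ 2 - B * y + C < 0 ->
  x < (B - Num.sqrt (B ^+ 2 - 4 * A * C)) / (2 * A).
Proof.
move=> A0 xy gx gy.
have Dx : B ^+ 2 - 4 * A * C < (2 * A * x - B) ^+ 2 by nra.
have Dy : (2 * A * y - B) ^+ 2 < B ^+ 2 - 4 * A * C by nra.
have D0 : 0 <= B ^+ 2 - 4 * A * C by rewrite (le_trans _ (ltW Dy))// sqr_ge0.
rewrite ltr_pdivlMr; last lra.
have := sqrtr_ge0 (B ^+ 2 - 4 * A * C); have := sqr_sqrtr D0.
move: (Num.sqrt _) => r rD r0; rewrite -rD in Dx Dy; rewrite ltNge; apply/negP => h.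
have yr : 2 * A * y - B < r by nra.
have xyA : 2 * A * x < 2 * A * y by rewrite ltr_pM2l//; lra.
by nra.
Qed.

Lemma smaller_root_eq0 (A B C : R) (t := (B - Num.sqrt (B ^+ 2 - 4 * A * C)) / (2 * A)) :
  0 < A -> 0 <= B ^+ 2 - 4 * A * C -> A * t ^+ 2 - B * t + C = 0.
Proof.
move=> A0 D0; have := sqr_sqrtr D0; rewrite /t.
move: (Num.sqrt _) => r rD.
have -> : C = (B ^+ 2 - r ^+ 2) / (4 * A) by rewrite rD; field; rewrite gt_eqF.
by field; rewrite gt_eqF.
Qed.

(** The left side minus 1 is a quadratic in [s] with leading coefficient [a - b] and roots [alpha]
    and [beta]. *)
Lemma slab_quadratic_le1 (alpha beta a b tau s : R) : b <= a ->
  a * (alpha - tau) ^+ 2 + b * (1 - alpha ^+ 2) = 1 ->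
  a * (beta - tau) ^+ 2 + b * (1 - beta ^+ 2) = 1 -> alpha < beta ->
  alpha <= s <= beta -> a * (s - tau) ^+ 2 + b * (1 - s ^+ 2) <= 1.
Proof.
move=> ba fa fb ab /andP[as_ sb].
have h : (beta - alpha) * (a * (s - tau) ^+ 2 + b * (1 - s ^+ 2) - 1) =
   (beta - alpha) * ((a - b) * ((s - alpha) * (s - beta))).
  have : (beta - s) * (a * (alpha - tau) ^+ 2 + b * (1 - alpha ^+ 2)) = beta - s.
    by rewrite fa mulr1.
  have : (s - alpha) * (a * (beta - tau) ^+ 2 + b * (1 - beta ^+ 2)) = s - alpha.
    by rewrite fb mulr1.
  by lra.
have {}h : a * (s - tau) ^+ 2 + b * (1 - s ^+ 2) - 1 = (a - b) * ((s - alpha) * (s - beta)).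
  by apply: mulfI h; rewrite gt_eqF// subr_gt0.
have : (a - b) * ((s - alpha) * (s - beta)) <= 0.
  by rewrite mulr_ge0_le0 ?mulr_ge0_le0 ?subr_ge0 ?subr_le0.
by rewrite -h; lra.
Qed.

End parameters.

(** * The three cases of the theorem; [N] is the dimension *)

Section cases.
Context {R : realType}.
Variable n : nat.
Implicit Types alpha beta : R.
Local Notation N := (GRing.one R *+ n.+1).

Let nE : n%:R = N - 1 :> R.
Proof. by rewrite -natr1 addrK. Qed.

Let opp1_lt_natM alpha beta : - N^-1 < alpha * beta -> - 1 < N * (alpha * beta).
Proof.
have N0 : 0 < N by rewrite ltr0n.
by rewrite -(ltr_pM2l N0) mulrN mulfV ?gt_eqF.
Qed.

(** The factor [t] is chosen so that [alpha * t * (beta * t) = - N^-1]; the hypothesis on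
    [alpha * beta] is what makes [t <= 1]. Both weight equations then hold with [a = b = 1] and
    [tau = 0]. *)
Lemma is_CE_ball_slab_ball alpha beta : (0 < n)%N -> -1 <= alpha -> alpha < beta ->
  beta <= 1 -> alpha * beta <= - N^-1 ->
  alpha < 0 < beta /\
  is_CE (@ball_slab R n.+1 alpha beta) (ellipsoid (diag_ab 1 1) ((0 : R) *: e1)).
Proof.
move=> n0 alpha1 ab beta1.
have N0 : 0 < N by rewrite ltr0n.
rewrite -(ler_pM2l N0) mulrN mulfV ?gt_eqF// => abN.
have N1 : 1 < N by rewrite ltr1n.
have ab0 : alpha * beta < 0.
  by rewrite -(pmulr_rlt0 _ N0) (le_lt_trans abN)// ltrN10.
have a0 : alpha < 0.
  rewrite ltNge; apply/negP => a0.
  by have := mulr_ge0 a0 (ltW (le_lt_trans a0 ab)); rewrite leNgt ab0.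
have b0 : 0 < beta by rewrite -(nmulr_rlt0 _ a0).
split; first by rewrite a0.
have Nm : 1 <= N * - (alpha * beta) by rewrite mulrN; lra.
(* The contact points lie on the slab [alpha t <= x_1 <= beta t]. *)
pose t := Num.sqrt (N * - (alpha * beta))^-1.
have t2 : t ^+ 2 * (N * - (alpha * beta)) = 1.
  by rewrite sqr_sqrtr ?mulVf ?gt_eqF// ?invr_ge0; lra.
have t0 : 0 < t by rewrite sqrtr_gt0 invr_gt0; lra.
have t1 : t <= 1 by rewrite -sqrtr1 ler_sqrt// invf_le1//; lra.
have atbt : N * (alpha * t * (beta * t)) = - 1.
  by apply: oppr_inj; rewrite opprK -[RHS]t2; ring.
apply: (@lowner_ball_slab R n alpha beta (alpha * t) (beta * t)) => //.
- nra.
- nra.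
- nra.
- nra.
- nra.
- by rewrite nE mul0r subr0 mulr1 mulrDr atbt mulr1.
- by move=> s _; lra.
Qed.

Lemma is_CE_ball_slab_sym alpha beta : (0 < n)%N -> -1 <= alpha -> alpha < beta ->
  beta <= 1 -> - N^-1 < alpha * beta -> alpha + beta = 0 ->
  let a := (N * beta ^+ 2)^-1 in
  let b := (N - 1) / (N * (1 - beta ^+ 2)) in
  [/\ 0 < a, 0 < b, alpha < 0 < beta &
    is_CE (@ball_slab R n.+1 alpha beta) (ellipsoid (diag_ab a b) ((0 : R) *: e1))].
Proof.
move=> n0 alpha1 ab beta1 /opp1_lt_natM abN s0 a b.
have N1 : 1 < N by rewrite ltr1n.
have alE : alpha = - beta by lra.
have b0 : 0 < beta by lra.
have Nb : N * beta ^+ 2 < 1.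
  by move: abN; rewrite alE mulNr mulrN ltrN2 -expr2.
have b2 : 0 < beta ^+ 2 by rewrite exprn_gt0.
have bb : 0 < 1 - beta ^+ 2 by nra.
have ap : 0 < a by rewrite invr_gt0 mulr_gt0//; lra.
have bp : 0 < b by rewrite divr_gt0 ?mulr_gt0//; lra.
have aE : N * a * beta ^+ 2 = 1 by rewrite /a; field; rewrite !gt_eqF//; lra.
have bE : N * b * (1 - beta ^+ 2) = N - 1.
  by rewrite /b; field; rewrite !gt_eqF//; lra.
(* [N] times this identity is the sum of [aE] and [bE]. *)
have fE : a * (beta - 0) ^+ 2 + b * (1 - beta ^+ 2) = 1.
  apply: (mulfI (_ : N != 0)); first by rewrite gt_eqF//; lra.
  by rewrite subr0; lra.
split=> //; first by rewrite b0 andbT; lra.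
(* After clearing denominators this is [N * beta ^+ 2 <= 1], which follows from [Nb]. *)
have ba : b <= a.
  rewrite -(ler_pM2l (_ : 0 < N * beta ^+ 2 * (1 - beta ^+ 2))); last first.
    by rewrite !mulr_gt0//; lra.
  have -> : N * beta ^+ 2 * (1 - beta ^+ 2) * b = (N - 1) * beta ^+ 2.
    by rewrite -bE; ring.
  have -> : N * beta ^+ 2 * (1 - beta ^+ 2) * a = 1 - beta ^+ 2.
    transitivity (N * a * beta ^+ 2 * (1 - beta ^+ 2)); first by ring.
    by rewrite aE mul1r.
  lra.
apply: (@lowner_ball_slab R n alpha beta alpha beta) => //; rewrite ?alE; try lra.
by move=> s sI; apply: (@slab_quadratic_le1 R (- beta) beta) => //; lra.
Qed.

Lemma is_CE_ball_slab_asym alpha beta : (0 < n)%N -> -1 <= alpha -> alpha < beta ->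
  beta <= 1 -> - N^-1 < alpha * beta ->
  alpha ^+ 2 <= beta ^+ 2 -> alpha + beta != 0 ->
  let Delta := N ^+ 2 * (beta ^+ 2 - alpha ^+ 2) ^+ 2
               + 4 * (1 - alpha ^+ 2) * (1 - beta ^+ 2) in
  let tau := (N * (beta + alpha) ^+ 2 + 2 * (1 + alpha * beta) - Num.sqrt Delta)
             / (2 * (N + 1) * (beta + alpha)) in
  let a := (N * (tau - alpha) * (beta - tau))^-1 in
  let b := (1 - a * (tau - alpha) ^+ 2) / (1 - alpha ^+ 2) in
  [/\ 0 < a, 0 < b, alpha < tau < beta &
    is_CE (@ball_slab R n.+1 alpha beta) (ellipsoid (diag_ab a b) (tau *: e1))].
Proof.
move=> n0 alpha1 ab beta1 /opp1_lt_natM abN sqr s0 Delta.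
have N1 : 1 < N by rewrite ltr1n.
have sig0 : 0 < beta + alpha.
  have h : 0 <= (beta - alpha) * (beta + alpha).
    by rewrite [leRHS](_ : _ = beta ^+ 2 - alpha ^+ 2) ?subr_ge0//; ring.
  by rewrite lt_def addrC s0/= addrC; rewrite pmulr_rge0 ?subr_gt0 in h.
have al2 : 0 < 1 - alpha ^+ 2.
  have -> : 1 - alpha ^+ 2 = (1 - alpha) * (1 + alpha) by ring.
  by rewrite mulr_gt0//; lra.
have Np : 0 < 1 + N * (alpha * beta) by rewrite addrC -ltrBlDr sub0r.
(* The quadratic with coefficients [A], [- B], [C] results from eliminating [a] and [b] among three
   conditions: the ellipsoid passes through the spheres at [alpha] and at [beta], and [aE] holds.
   Its smaller root is [tau]. *)
pose sig := beta + alpha; pose A := (N + 1) * sig.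
pose B := N * sig ^+ 2 + 2 * (1 + alpha * beta).
pose C := sig * (1 + N * (alpha * beta)).
have A0 : 0 < A by rewrite mulr_gt0//; lra.
have DE : Delta = B ^+ 2 - 4 * A * C by rewrite /Delta /A /B /C /sig; ring.
move=> tau a b.
have tauE : tau = (B - Num.sqrt (B ^+ 2 - 4 * A * C)) / (2 * A).
  by rewrite -DE /tau; congr (_ / _); rewrite /A mulrA.
have D0 : 0 <= B ^+ 2 - 4 * A * C.
  rewrite -DE addr_ge0// mulr_ge0 ?sqr_ge0//; [nra|nra].
(* The signs at [sig / 2], [alpha] and [0] place [tau] above both [alpha] and [0] and below the
   midpoint. Later [tau < sig / 2] yields [0 < b], and [0 < tau] yields [b <= a]. *)
have gmid : A * (sig / 2) ^+ 2 - B * (sig / 2) + C < 0.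
  rewrite [ltLHS](_ : _ = - ((N - 1) * sig * ((beta - alpha) / 2) ^+ 2)).
    rewrite oppr_lt0 mulr_gt0//; first by rewrite mulr_gt0//; lra.
    by rewrite exprn_gt0// divr_gt0// subr_gt0.
  by rewrite /A /B /C /sig; field.
have galpha : 0 < A * alpha ^+ 2 - B * alpha + C.
  rewrite [ltRHS](_ : _ = (beta - alpha) * (1 - alpha ^+ 2)).
    by rewrite mulr_gt0// subr_gt0.
  by rewrite /A /B /C /sig; ring.
have g0 : 0 < A * 0 ^+ 2 - B * 0 + C.
  by rewrite expr0n/= !mulr0 subr0 add0r mulr_gt0.
have tau_mid : tau < sig / 2 by rewrite tauE; exact: smaller_root_lt.
have tau0 : 0 < tau.
  by rewrite tauE; apply: lt_smaller_root gmid => //; rewrite divr_gt0.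
have alpha_tau : alpha < tau.
  by rewrite tauE; apply: lt_smaller_root gmid => //; rewrite /sig; lra.
have tau_beta : tau < beta by move: tau_mid; rewrite /sig; lra.
have gtau : A * tau ^+ 2 - B * tau + C = 0.
  by rewrite tauE; exact: smaller_root_eq0.
have ta : 0 < tau - alpha by rewrite subr_gt0.
have bt : 0 < beta - tau by rewrite subr_gt0.
have P0 : 0 < N * (tau - alpha) * (beta - tau) by rewrite !mulr_gt0//; lra.
have a0 : 0 < a by rewrite invr_gt0.
have aE : N * a * ((tau - alpha) * (beta - tau)) = 1.
  transitivity (N * (tau - alpha) * (beta - tau) * a); first by ring.
  by rewrite mulfV ?gt_eqF.
clearbody tau a.
have fa : a * (alpha - tau) ^+ 2 + b * (1 - alpha ^+ 2) = 1.
  by rewrite /b divfK ?gt_eqF//; ring.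
clearbody b.
(* This relation is equivalent to equal values at [alpha] and [beta]. Once 1 is replaced using [aE],
   the two sides times [1 - alpha ^+ 2] differ by a multiple of the quadratic at [tau]. *)
have bE : sig * b = a * (sig - 2 * tau).
  apply: (mulIf (lt0r_neq0 al2)).
  have -> : sig * b * (1 - alpha ^+ 2) = sig * (1 - a * (tau - alpha) ^+ 2).
    by rewrite -mulrA; congr (_ * _); lra.
  transitivity (sig * (N * a * ((tau - alpha) * (beta - tau)) - a * (tau - alpha) ^+ 2)).
    by rewrite aE.
  apply/eqP; rewrite -subr_eq0; apply/eqP.
  transitivity (- a * (A * tau ^+ 2 - B * tau + C)).
    by rewrite /A /B /C /sig; ring.
  by rewrite gtau mulr0.
have b0 : 0 < b.
  by rewrite -(pmulr_rgt0 _ sig0) bE mulr_gt0//; lra.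
have ba : b <= a.
  by rewrite -(ler_pM2l sig0) -/sig bE; have := mulr_gt0 a0 tau0; lra.
have fb : a * (beta - tau) ^+ 2 + b * (1 - beta ^+ 2) = 1.
  apply: etrans fa; apply/eqP; rewrite -subr_eq0; apply/eqP.
  transitivity ((beta - alpha) * (a * (sig - 2 * tau) - sig * b)).
    by rewrite /sig; ring.
  by rewrite bE subrr mulr0.
split=> //; first by rewrite alpha_tau.
apply: (@lowner_ball_slab R n alpha beta alpha beta) => //.
(* The weight equation for [b], multiplied by [sig] so that [bE] eliminates [b], again reduces to
   the quadratic at [tau]. *)
- apply: (mulfI (lt0r_neq0 sig0)); rewrite nE.
  transitivity (N * (sig * b) * (1 + alpha * beta - tau * sig)).
    by rewrite /sig; ring.
  transitivity (N * a * ((tau - alpha) * (beta - tau)) * (sig * (N - 1))).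
    rewrite bE; apply/eqP; rewrite -subr_eq0; apply/eqP.
    transitivity (N * a * (A * tau ^+ 2 - B * tau + C)).
      by rewrite /A /B /C /sig; ring.
    by rewrite gtau mulr0.
  by rewrite aE mul1r.
- by move=> s; exact: slab_quadratic_le1.
Qed.

End cases.

Theorem theorem6p1 (R : realType) (n : nat) (hn : (2 <= n)%N)
    (alpha beta : R) (h1alpha : -1 <= alpha) (halphabeta : alpha < beta)
    (hbeta1 : beta <= 1) (hsqr : alpha ^+ 2 <= beta ^+ 2) :
  exists tau a b : R,
    [/\ 0 < a, 0 < b, alpha < tau < beta,
        is_CE (@ball_slab R n alpha beta)
              (ellipsoid (diag_ab a b) (tau *: e1)) &
        [/\ alpha * beta <= - n%:R^-1 ->
              [/\ tau = 0, a = 1 & b = 1],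
            alpha + beta = 0 -> alpha * beta > - n%:R^-1 ->
              [/\ tau = 0,
                  a = (n%:R * beta ^+ 2)^-1 &
                  b = (n%:R - 1) / (n%:R * (1 - beta ^+ 2))] &
            alpha + beta != 0 -> alpha * beta > - n%:R^-1 ->
              let Delta := n%:R ^+ 2 * (beta ^+ 2 - alpha ^+ 2) ^+ 2
                           + 4 * (1 - alpha ^+ 2) * (1 - beta ^+ 2) in
              [/\ tau = (n%:R * (beta + alpha) ^+ 2 + 2 * (1 + alpha * beta)
                         - Num.sqrt Delta)
                        / (2 * (n%:R + 1) * (beta + alpha)),
                  a = (n%:R * (tau - alpha) * (beta - tau))^-1 &
                  b = (1 - a * (tau - alpha) ^+ 2) / (1 - alpha ^+ 2)]]].
Proof.
case: n hn => [//|n] n0.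
have [abN|abN] := leP (alpha * beta) (- n.+1%:R^-1).
  have [t01 CE] := is_CE_ball_slab_ball n0 h1alpha halphabeta hbeta1 abN.
  by exists 0, 1, 1; rewrite ltr01; split=> //; split.
have [s0|s0] := eqVneq (alpha + beta) 0.
  have [a0 b0 t0 CE] := is_CE_ball_slab_sym n0 h1alpha halphabeta hbeta1 abN s0.
  by do 3 eexists; split; [exact: a0|exact: b0|exact: t0|exact: CE|split].
have [a0 b0 t0 CE] := is_CE_ball_slab_asym n0 h1alpha halphabeta hbeta1 abN hsqr s0.
do 3 eexists; split; [exact: a0|exact: b0|exact: t0|exact: CE|split=> //].
by move=> /eqP; rewrite (negPf s0).
Qed.
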